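(* Let $\varphi$ be a sequence of pivot operations applicable to a finite simple graph $G$, and let $S=\sup(\varphi)$. Then for vertices $x,y$ with $x\neq y$, $\{x,y\}\in E(G\varphi)$ if and only if $\mathrm{pm}(G|_{S\oplus\{x,y\}})=1$.
   Context: For a graph $H$, $\mathrm{pm}(H)$ is the number of perfect matchings of $H$ modulo $2$ (the empty graph has exactly one perfect matching). $G|_X$ is the induced subgraph on $X$, and $\oplus$ is symmetric difference. For a vertex $x$, $N'(x)=N(x)\cup\{x\}$. Pivot: for an edge $\{u,v\}$, let $V_1=N'(u)\setminus N'(v)$, $V_2=N'(v)\setminus N'(u)$, $V_3=N'(u)\cap N'(v)$; $G[uv]$ is obtained by toggling every pair $\{x,y\}$ with $x\in V_i$, $y\in V_j$, $i\neq j$. A sequence $[v_1v_2]\cdots[v_{n-1}v_n]$ is applicable to $G$ if each $\{v_i,v_{i+1}\}$ is an edge of the graph obtained by applying the preceding pivots; $G\varphi$ is the result. The support $\sup(\varphi)=\{v_1\}\oplus\cdots\oplus\{v_n\}$ is the set of vertices occurring an odd number of times. *)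

(* Defs.v *)
From mathcomp Require Import all_boot.
Set Implicit Arguments.
Unset Strict Implicit.
Unset Printing Implicit Defensive.

(* A finite simple graph with vertex type T is a symmetric irreflexive
   relation G : rel T. Pivoting keeps the vertex type and changes only G. *)

Section PivotGraphs.
Variable T : finType.
Implicit Types (G : rel T) (A B X V : {set T}) (E M : {set {set T}}).
Implicit Types (u v x y : T) (phi : seq (T * T)).

Definition symdiff A B : {set T} := (A :\: B) :|: (B :\: A).

Definition edges G : {set {set T}} :=
  [set [set p.1; p.2] | p in [pred p : T * T | G p.1 p.2]].

(* Edge set of G|_X, the vertex set of which is X. *)
Definition induced_edges G X : {set {set T}} :=
  [set e in edges G | e \subset X].

(* H is given by its vertex set V and its edge set E; the blocks of a
   partition are pairwise disjoint, nonempty and cover V. *)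
Definition perfect_matching V E M : bool := (M \subset E) && partition M V.

Definition pm V E : nat := #|[set M | perfect_matching V E M]| %% 2.

Definition pm_induced G X : nat := pm X (induced_edges G X).

Definition closed_nbhd G x : {set T} := x |: [set y | G x y].

Definition pivot_class G u v (i : 'I_3) : {set T} :=
  match val i with
  | 0 => closed_nbhd G u :\: closed_nbhd G v
  | 1 => closed_nbhd G v :\: closed_nbhd G u
  | _ => closed_nbhd G u :&: closed_nbhd G v
  end.

(* The three classes are disjoint, so each pair is toggled at most once. *)
Definition pivot G u v : rel T := fun x y =>
  G x y (+) [exists i : 'I_3, exists j : 'I_3,
    [&& i != j, x \in pivot_class G u v i & y \in pivot_class G u v j]].

(* A sequence [v_1 v_2][v_3 v_4]... is the list of the pairs (v_1, v_2),
   (v_3, v_4), ..., applied from left to right. *)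
Fixpoint applicable G phi : bool :=
  if phi is (u, v) :: phi' then G u v && applicable (pivot G u v) phi'
  else true.

Fixpoint pivots G phi : rel T :=
  if phi is (u, v) :: phi' then pivots (pivot G u v) phi' else G.

Definition pivot_vertices phi : seq T :=
  flatten [seq [:: p.1; p.2] | p <- phi].

Definition pivot_support phi : {set T} :=
  \big[symdiff/set0]_(v <- pivot_vertices phi) [set v].

Lemma in_symdiff A B x : (x \in symdiff A B) = (x \in A) (+) (x \in B).
Proof. by rewrite !inE; case: (x \in A); case: (x \in B). Qed.

Lemma in_pivot_support phi x :
  (x \in pivot_support phi) = odd (count_mem x (pivot_vertices phi)).
Proof.
rewrite /pivot_support; elim: (pivot_vertices phi) => [|v s IHs].
  by rewrite big_nil inE.
by rewrite big_cons in_symdiff IHs inE /= oddD oddb eq_sym.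
Qed.

Lemma pivot_sym G u v : symmetric G -> symmetric (pivot G u v).
Proof.
move=> symG x y; rewrite /pivot symG; congr (_ (+) _).
by apply/existsP/existsP => -[i /existsP[j /and3P[ij xi yj]]];
  exists j; apply/existsP; exists i; rewrite eq_sym ij xi yj.
Qed.

Lemma pivot_irr G u v : irreflexive G -> irreflexive (pivot G u v).
Proof.
move=> irrG x; rewrite /pivot irrG addFb; apply/negbTE/negP.
case/existsP=> i /existsP[j]; rewrite /pivot_class.
by case: i j => [[|[|[|//]]] ?] [[|[|[|//]]] ?] /and3P[];
  rewrite // !inE; do 2!case: (_ || _).
Qed.

End PivotGraphs.

(* Main.v *)
Require Import Defs.
From mathcomp Require Import all_boot.
Set Implicit Arguments.
Unset Strict Implicit.
Unset Printing Implicit Defensive.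

(** Counted modulo 2, the perfect matchings of the induced subgraphs are the
    Pfaffian minors of the adjacency matrix over F_2. Expanding along a vertex
    yields the Wick relations
      sum_(i in I (+) J) f(I (+) {i}) f(J (+) {i}) = 0,
    which are stable under the twist f(X) |-> f(A (+) X). If f(A) = 1, the
    twisted function therefore again satisfies the expansion along a vertex,
    with its values on pairs as adjacency matrix. For A = {u, v} this matrix is
    the one of G[uv], so a pivot translates matching parities by {u, v}. *)

Section MatchingParity.
Variable T : finType.
Implicit Types (G : rel T) (A B I J X : {set T}) (M : {set {set T}}).
Implicit Types (u v x y : T) (f g : {set T} -> bool).

(** * Matchings of induced subgraphs and their expansion along a vertex *)

Definition pm_parity G X : bool := odd (pm_induced G X).

Lemma pm_induced_eq1 G X : pm_induced G X = 1 <-> pm_parity G X.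
Proof. by rewrite /pm_parity /pm_induced /pm modn2 oddb; case: odd. Qed.

(** The blocks of a partition of [X] lie in [X] anyway, so being edges of [G] suffices. *)
Lemma perfect_matching_induced G X M :
  perfect_matching X (induced_edges G X) M = (M \subset edges G) && partition M X.
Proof.
rewrite /perfect_matching; case partM: (partition M X); rewrite ?andbF // !andbT.
apply/subsetP/subsetP => sM e eM; first by have:= sM e eM; rewrite inE => /andP[].
by rewrite inE sM //= (partitionS partM).
Qed.

Lemma in_edges G (G_sym : symmetric G) x y : ([set x; y] \in edges G) = G x y.
Proof.
apply/imsetP/idP => [[[a b] /=]|Gxy]; last by exists (x, y).
rewrite inE /= => Gab /setP eq_e.
move: (eq_e x) (eq_e y) (eq_e a) (eq_e b); rewrite !inE !eqxx /= ?orbT.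
move=> /esym/orP[]/eqP-> /esym/orP[]/eqP-> /orP[]/eqP eq_a /orP[]/eqP eq_b //;
  subst; by rewrite // G_sym.
Qed.

Lemma edge_at G (G_sym : symmetric G) x (e : {set T}) :
  e \in edges G -> x \in e -> exists2 y, e = [set x; y] & G x y.
Proof.
case/imsetP => -[a b]; rewrite inE /= => Gab ->; rewrite !inE.
case/orP => /eqP->; first by exists b.
by exists a; rewrite 1?setUC // G_sym.
Qed.

Definition matchings G X : {set {set {set T}}} :=
  [set M : {set {set T}} | (M \subset edges G) && partition M X].

Lemma pm_parityE G X : pm_parity G X = odd #|matchings G X|.
Proof.
rewrite /pm_parity /pm_induced /pm modn2 oddb; congr (odd _).
by apply: eq_card => M; rewrite !inE perfect_matching_induced.
Qed.

Lemma pm_parity0 G : pm_parity G set0.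
Proof.
rewrite pm_parityE (_ : matchings G set0 = [set set0]) ?cards1 //.
apply/setP => M; rewrite !inE partition_set0.
by case: eqP => [->|]; rewrite ?sub0set ?andbF.
Qed.

(** Adding the edge [[set x; y]] is a bijection from the matchings of the smaller set; its inverse
    deletes that edge. *)
Lemma card_matchings_with G (G_sym : symmetric G) X x y :
  x \in X -> y \in X -> G x y ->
  #|[set M in matchings G X | [set x; y] \in M]| = #|matchings G (X :\ x :\ y)|.
Proof.
move=> xX yX Gxy; set e := [set x; y].
have XDe : X :\ x :\ y = X :\: e by rewrite /e setDDl.
have eX : e \subset X by rewrite subUset !sub1set xX yX.
have e_neq0 : e != set0 by apply/set0Pn; exists x; rewrite set21.
have eU : e :|: (X :\: e) = X by rewrite -{1}(setIidPr eX) setID.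
have dis_e : [disjoint e & X :\: e] by rewrite -setI_eq0 setIDA setDIl setDv set0I.
have e_edge : e \in edges G by rewrite in_edges.
rewrite XDe; pose F M := e |: M.
have notin M : M \in matchings G (X :\: e) -> e \notin M.
  rewrite inE => /andP[_ partM]; apply/negP => eM.
  have /subsetP/(_ x) := partitionS partM eM.
  by rewrite !inE eqxx /= => /(_ isT).
rewrite -(card_in_imset (f := F) (D := mem (matchings G (X :\: e)))); last first.
  move=> M N /notin eM /notin eN eqF.
  by rewrite -(setU1K eM) -(setU1K eN) -/(F M) eqF.
apply: eq_card => M; apply/idP/imsetP => [|[N mN ->]].
  rewrite !inE => /andP[/andP[sM partM] eM]; exists (M :\ e); last first.
    by rewrite /F setD1K.
  by rewrite inE (partitionD1 partM eM) (subset_trans (subsetDl _ _) sM).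
move: mN; rewrite !inE eqxx andbT => /andP[sN partN].
by rewrite subUset sub1set e_edge sN -[X in partition _ X]eU partitionU1.
Qed.

(** Double counting: each matching covers [x] by exactly one edge, so its partners [y] contribute 1
    in total, and the two sums are exchanged. *)
Lemma card_matchings G (G_sym : symmetric G) (G_irr : irreflexive G) X x :
  x \in X ->
  #|matchings G X| = \sum_(y in X) G x y * #|matchings G (X :\ x :\ y)|.
Proof.
move=> xX.
have partner M : M \in matchings G X -> \sum_(y in X) ([set x; y] \in M : nat) = 1.
  rewrite inE => /andP[/subsetP sM partM].
  have [/eqP covM triv _] := and3P partM.
  have /bigcupP[e eM xe] : x \in cover M by rewrite covM.
  have [y def_e Gxy] := edge_at G_sym (sM _ eM) xe.
  have yX : y \in X by rewrite (subsetP (partitionS partM eM)) // def_e set22.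
  rewrite (bigD1 y) //= -def_e eM big1 // => z /andP[_ zy].
  case zM: (_ \in M) => //; case/negP: zy.
  have : z \in e.
    by rewrite -(def_pblock triv eM xe) (def_pblock triv zM) ?set21 ?set22.
  rewrite def_e !inE => /orP[|//] /eqP zx.
  by have:= sM _ zM; rewrite in_edges // zx G_irr.
rewrite -sum1_card -(eq_bigr _ partner) exchange_big /=.
apply: eq_bigr => y yX; case Gxy: (G x y).
  rewrite mul1n -card_matchings_with // -sum1_card [RHS]big_mkcond /=.
  rewrite [LHS]big_mkcond; apply: eq_bigr => M _; rewrite !inE.
  by case: (_ && _) => //=; case: (_ \in M).
rewrite mul0n big1 // => M; rewrite inE => /andP[/subsetP sM _].
by case eM: (_ \in M) => //; have:= sM _ eM; rewrite in_edges // Gxy.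
Qed.

(** Pfaffian expansion over F_2, where signs disappear. The term [y = x] vanishes once [a] is
    irreflexive. *)
Definition row_expansion (a : rel T) f :=
  forall X x, x \in X ->
    f X = \big[addb/false]_(y in X) (a x y && f (X :\ x :\ y)).

Lemma pm_parity_row G : symmetric G -> irreflexive G ->
  row_expansion G (pm_parity G).
Proof.
move=> G_sym G_irr X x xX; rewrite pm_parityE (card_matchings _ _ xX) //.
rewrite (big_morph odd oddD (erefl : odd 0 = false)).
by apply: eq_bigr => y _; rewrite oddM oddb pm_parityE.
Qed.

(** * Wick relations *)

Lemma addb_sym_sum (h : T -> T -> bool) (r : seq T) :
  (forall x, h x x = false) -> (forall x y, h x y = h y x) ->
  \big[addb/false]_(x <- r) \big[addb/false]_(y <- r) h x y = false.
Proof.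
move=> h0 hC; elim: r => [|z r IHr]; first by rewrite big_nil.
rewrite big_cons big_cons h0 /=.
rewrite [X in _ (+) X](eq_bigr
  (fun x => h x z (+) \big[addb/false]_(y <- r) h x y));
  last by move=> x _; rewrite big_cons.
rewrite big_split /= IHr addbF.
apply: etrans (addbb (\big[addb/false]_(y <- r) h z y)).
by congr (_ (+) _); apply: eq_bigr => x _; apply: hC.
Qed.

Lemma setD1AC A x y : A :\ x :\ y = A :\ y :\ x.
Proof. by rewrite setDDl setUC -setDDl. Qed.

Section Wick.
Variables (G : rel T) (f : {set T} -> bool).
Hypotheses (G_irr : irreflexive G) (f_row : row_expansion G f).

(* Expanding once more along i makes the sum symmetric in the two removed
   neighbours: a Pfaffian with a repeated row vanishes. *)
Lemma repeated_row J i : i \in J ->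
  \big[addb/false]_(k in J) (G i k && f (J :\ k)) = false.
Proof.
move=> iJ.
pose h k l := [&& k \in J, l \in J, k != l, G i k, G i l & f (J :\ i :\ k :\ l)].
rewrite -[RHS](@addb_sym_sum h (index_enum T)); last first.
- move=> k l; rewrite /h [l == k]eq_sym setD1AC.
  by case: (k \in J); case: (l \in J); case: (G i k); case: (G i l).
- by move=> k; rewrite /h eqxx !andbF.
rewrite big_mkcond; apply: eq_bigr => k _; rewrite /h.
case kJ: (k \in J) => /=; last by rewrite big1.
case Gik: (G i k) => /=; last by rewrite big1 // => l _; rewrite !andbF.
have ik : i != k by apply: contraTneq Gik => ->; rewrite G_irr.
rewrite (f_row (x := i)) ?inE ?ik // big_mkcond; apply: eq_bigr => l _.
rewrite !inE [l == k]eq_sym [J :\ k :\ i]setD1AC.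
by case: (l \in J); rewrite ?andbF //=; case: (k == l).
Qed.

(** For [i] outside [J] the sum expands [i |: J] along [i]; for [i] inside it is a repeated row. The
    guard merges both cases, so that [wick] can sum over all [i]. *)
Lemma toggle_row J i :
  (i \notin J) && f (symdiff J [set i]) =
  \big[addb/false]_(k in J) (G i k && f (J :\ k)).
Proof.
case: (boolP (i \in J)) => [/repeated_row-> //|iJ] /=.
have -> : symdiff J [set i] = i |: J.
  apply/setP => z; rewrite in_symdiff !inE; case: eqP => [->|_].
    by rewrite (negbTE iJ).
  by rewrite addbF.
rewrite (f_row (x := i)) ?setU11 // big_setU1 //= G_irr /=.
by apply: eq_bigr => k kJ; rewrite setU1K.
Qed.

End Wick.

Lemma symdiff1_in J i : i \in J -> symdiff J [set i] = J :\ i.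
Proof.
move=> iJ; apply/setP => z; rewrite in_symdiff !inE.
by case: eqP => [->|_]; rewrite ?iJ ?addbF.
Qed.

(** The double sum [s I J] is symmetric because [G] is. By [toggle_row], [s I J] collects the terms
    with [i] in [I :\: J] and [s J I] those in [J :\: I]; together they give the relation. *)
Lemma wick G f I J : symmetric G -> irreflexive G -> row_expansion G f ->
  \big[addb/false]_(i in symdiff I J)
    (f (symdiff I [set i]) && f (symdiff J [set i])) = false.
Proof.
move=> G_sym G_irr f_row.
pose s A B := \big[addb/false]_(i in A) \big[addb/false]_(k in B)
                (f (A :\ i) && (G i k && f (B :\ k))).
have sE A B : s A B = \big[addb/false]_(i in A)
    (f (symdiff A [set i]) && ((i \notin B) && f (symdiff B [set i]))).
  apply: eq_bigr => i iA; rewrite (toggle_row G_irr f_row) // big_distrr /=.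
  by rewrite symdiff1_in.
have sC : s I J = s J I.
  rewrite /s exchange_big; apply: eq_bigr => k _; apply: eq_bigr => i _.
  by rewrite G_sym andbCA [RHS]andbCA; bool_congr; rewrite andbC.
apply: etrans (addbb (s I J)).
rewrite {2}sC !sE big_mkcond [X in _ = X (+) _]big_mkcond.
rewrite [X in _ = _ (+) X]big_mkcond -big_split; apply: eq_bigr => i _ /=.
rewrite in_symdiff; case: (i \in I); case: (i \in J); rewrite ?andbF ?addbF //=.
exact: andbC.
Qed.

(** * Twisting, and uniqueness of the expansion *)

Lemma symdiffA : associative (@symdiff T).
Proof. by move=> A B C; apply/setP => z; rewrite !in_symdiff addbA. Qed.

Lemma symdiff0 A : symdiff A set0 = A.
Proof. by apply/setP => z; rewrite in_symdiff inE addbF. Qed.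

(** The Wick relation is taken at two sets whose symmetric difference is [X]. Its term at [x] is the
    left side, since [f A] holds; its other terms form the expansion. *)
Lemma twist_row G f A : symmetric G -> irreflexive G -> row_expansion G f ->
  f A -> row_expansion (fun x y => (x != y) && f (symdiff A [set x; y]))
                       (fun X => f (symdiff A X)).
Proof.
move=> G_sym G_irr f_row fA X x xX.
have := wick (symdiff A (X :\ x)) (symdiff A [set x]) G_sym G_irr f_row.
have -> : symdiff (symdiff A (X :\ x)) (symdiff A [set x]) = X.
  apply/setP => z; rewrite !in_symdiff !inE.
  by case: eqP => [->|_]; rewrite ?xX;
    case: (z \in A); case: (z \in X); case: (x \in A).
rewrite (bigD1 x) //= -!symdiffA.
have -> : symdiff (X :\ x) [set x] = X.
  apply/setP => z; rewrite in_symdiff !inE.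
  by case: eqP => [->|_]; rewrite ?xX ?addbF.
have -> : symdiff [set x] [set x] = set0.
  by apply/setP => z; rewrite in_symdiff addbb inE.
rewrite symdiff0 fA andbT => /(canRL (addbK _)) ->; rewrite addFb.
rewrite [RHS](bigD1 x) //= eqxx addFb; apply: eq_bigr => y /andP[yX yx].
rewrite eq_sym yx andbC /= -!symdiffA [symdiff (X :\ x) _]symdiff1_in ?inE ?yx //.
congr (f (symdiff A _) && _); apply/setP => z; rewrite in_symdiff !inE.
by case: (z =P x) => [->|]; rewrite // eq_sym (negbTE yx).
Qed.

(** Induction on the size of [X]: the expansion reduces every value to smaller sets, down to
    [set0]. *)
Lemma row_expansion_eq a b f g :
  row_expansion a f -> row_expansion b g -> f set0 = g set0 ->
  (forall x y, a x y = b x y) -> forall X, f X = g X.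
Proof.
move=> f_row g_row fg0 ab X; have [n] := ubnP #|X|; elim: n X => // n IHn X ltXn.
have [->//|[x xX]] := set_0Vmem X.
rewrite (f_row _ _ xX) (g_row _ _ xX); apply: eq_bigr => y yX; rewrite ab.
congr (_ && _); apply: IHn.
apply: leq_ltn_trans (subset_leq_card (subsetDl _ _)) _.
by rewrite (cardsD1 x X) xX in ltXn.
Qed.

(** * Effect of a single pivot *)

Section Pivot.
Variable G : rel T.
Hypotheses (G_sym : symmetric G) (G_irr : irreflexive G).

Lemma pm_parity2 x y : x != y -> pm_parity G [set x; y] = G x y.
Proof.
move=> xy; rewrite (pm_parity_row _ _ (x := x)) ?set21 //.
rewrite big_setU1 ?inE //= big_set1.
rewrite G_irr /= (_ : _ :\ y = set0) ?pm_parity0 ?andbT //.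
by apply/setP => z; rewrite !inE; case: eqP; case: eqP.
Qed.

Lemma pm_parity4 a b c d : uniq [:: a; b; c; d] ->
  pm_parity G [set a; b; c; d] =
  (G a b && G c d) (+) (G a c && G b d) (+) (G a d && G b c).
Proof.
rewrite /= !inE !negb_or !andbT => /and3P[/and3P[ab ac ad] /andP[bc bd] cd].
rewrite (pm_parity_row _ _ (x := a)) ?inE ?eqxx // -!setUA.
rewrite !big_setU1 ?inE ?negb_or ?ab ?ac ?bc ?ad ?bd //= big_set1 G_irr /= -addbA.
have [[nab nac] nad] := (negbTE ab, negbTE ac, negbTE ad).
have [[nbc nbd] ncd] := (negbTE bc, negbTE bd, negbTE cd).
congr (_ (+) (_ (+) _)); congr (_ && _); rewrite -pm_parity2 //; congr pm_parity;
  apply/setP => t; rewrite !inE; case: (t =P a) => [->|_];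
  rewrite ?nab ?nac ?nad ?andbF //=.
- by case: (t =P b) => [->|_]; rewrite ?nbc ?nbd.
- by case: (t =P c) => [->|_]; rewrite // [c == b]eq_sym ?nbc ?ncd.
- by case: (t =P d) => [->|_]; rewrite ?orbF // ![d == _]eq_sym ?nbd ?ncd.
Qed.

(** The vector [(p u x, p v x)] over F_2 encodes the class of [x], zero meaning no class. Two
    vectors are nonzero and distinct exactly when their determinant is 1. *)
Lemma pivotE u v x y (p := fun a b : T => (b == a) || G a b) :
  pivot G u v x y = G x y (+) ((p u x && p v y) (+) (p v x && p u y)).
Proof.
congr (_ (+) _); have in_p a b : (b \in closed_nbhd G a) = p a b by rewrite !inE.
(* One disjunct for each class of [x], stating that [y] lies in one of the two other classes. *)
transitivity [|| (p u x && ~~ p v x) && p v y, (p v x && ~~ p u x) && p u y |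
  (p u x && p v x) && (p u y (+) p v y)].
  apply/existsP/idP => [[i /existsP[j /and3P[]]]|].
    by case: i j => [[|[|[|//]]] ?] [[|[|[|//]]] ?] // _;
      rewrite /pivot_class /= !inE -/(p u x) -/(p v x) -/(p u y) -/(p v y);
      do 4!case: (p _ _).
  set E := exists i, _.
  have mem i j :
      [&& i != j, x \in pivot_class G u v i & y \in pivot_class G u v j] -> E.
    by move=> h; exists i; apply/existsP; exists j.
  pose o0 := @Ordinal 3 0 isT; pose o1 := @Ordinal 3 1 isT.
  pose o2 := @Ordinal 3 2 isT.
  move: (mem o0 o1) (mem o0 o2) (mem o1 o0) (mem o1 o2) (mem o2 o0) (mem o2 o1).
  rewrite /pivot_class /= !in_setD !in_setI !in_p.
  by do 4!case: (p _ _) => /=; auto.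
by do 4!case: (p _ _).
Qed.

(** The cases are how [[set x; y]] meets [[set u; v]]: the symmetric difference has 0, 2 or 4
    elements. *)
Lemma pivot_pm_parity2 u v x y : G u v -> x != y ->
  pivot G u v x y = pm_parity G (symdiff [set u; v] [set x; y]).
Proof.
move=> Guv xy; rewrite pivotE /=.
have uv : u != v by apply: contraTneq Guv => ->; rewrite G_irr.
have Gvu : G v u by rewrite G_sym.
have nuv := negbTE uv; have nvu : (v == u) = false by rewrite eq_sym.
have xor2 a b c : a != b -> a != c -> b != c ->
    symdiff [set a; b] [set a; c] = [set b; c].
  move=> ab ac bc; apply/setP => t; rewrite in_symdiff !inE.
  case: (t =P a) => [->|_]; first by rewrite (negbTE ab) (negbTE ac).
  by case: (t =P b) => [->|_] //; rewrite (negbTE bc).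
have [xu|xu] := eqVneq x u; have [yu|yu] := eqVneq y u.
- by rewrite xu yu eqxx in xy.
- have [yv|yv] := eqVneq y v.
    have -> : symdiff [set u; v] [set x; y] = set0.
      by apply/setP => t; rewrite xu yv in_symdiff addbb inE.
    by rewrite pm_parity0 xu yv ?eqxx ?nuv ?nvu ?G_irr Guv Gvu.
  rewrite xu xor2 1?eq_sym // 1?eq_sym // pm_parity2 1?eq_sym //.
  rewrite ?eqxx ?(negbTE yu) ?(negbTE yv) ?nuv Gvu ?orbT /=.
  by case: (G u y); case: (G v y).
- have [xv|xv] := eqVneq x v.
    have -> : symdiff [set u; v] [set x; y] = set0.
      by apply/setP => t; rewrite xv yu [[set v; u]]setUC in_symdiff addbb inE.
    by rewrite pm_parity0 xv yu ?eqxx ?nuv ?nvu ?G_irr Guv Gvu.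
  rewrite yu [[set x; u]]setUC xor2 1?eq_sym // 1?eq_sym // pm_parity2 1?eq_sym //.
  rewrite ?eqxx ?(negbTE xu) ?(negbTE xv) ?nuv Gvu ?orbT /= [G x u]G_sym.
  by case: (G u x); case: (G v x).
have [xv|xv] := eqVneq x v; have [yv|yv] := eqVneq y v.
- by rewrite xv yv eqxx in xy.
- rewrite xv [[set u; v]]setUC xor2 1?eq_sym // 1?eq_sym // pm_parity2 1?eq_sym //.
  rewrite ?eqxx ?(negbTE yu) ?(negbTE yv) ?nvu Guv ?orbT /=.
  by case: (G u y); case: (G v y).
- rewrite yv [[set u; v]]setUC [[set x; v]]setUC xor2 1?eq_sym // 1?eq_sym //.
  rewrite pm_parity2 1?eq_sym // ?eqxx ?(negbTE xu) ?(negbTE xv) ?nvu.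
  rewrite Guv ?orbT /= [G x v]G_sym.
  by case: (G u x); case: (G v x).
(* For disjoint pairs [p] is plain adjacency. As [G u v] holds, the three pairings of the four
   vertices give [G x y] and the two toggling terms. *)
have -> : symdiff [set u; v] [set x; y] = [set u; v; x; y].
  apply/setP => t; rewrite in_symdiff !inE.
  case: (t =P u) => [->|_];
    first by rewrite ![u == _]eq_sym (negbTE xu) (negbTE yu).
  by case: (t =P v) => [->|_] //=; rewrite ![v == _]eq_sym (negbTE xv) (negbTE yv).
rewrite pm_parity4 /= ?inE ?negb_or ?[u == _]eq_sym ?[v == _]eq_sym
  ?uv ?xu ?yu ?xv ?yv ?xy //.
by rewrite Guv /= addbA [G u y && _]andbC.
Qed.

(** Both sides are row expansions with the same adjacency relation and the same value at [set0]. *)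
Lemma pm_parity_pivot u v : G u v ->
  forall X, pm_parity (pivot G u v) X = pm_parity G (symdiff [set u; v] X).
Proof.
move=> Guv; have uv : u != v by apply: contraTneq Guv => ->; rewrite G_irr.
have fuv : pm_parity G [set u; v] by rewrite pm_parity2.
have row := pm_parity_row (pivot_sym u v G_sym) (pivot_irr u v G_irr).
apply: row_expansion_eq row
  (twist_row G_sym G_irr (pm_parity_row G_sym G_irr) fuv) _ _.
  by rewrite symdiff0 fuv pm_parity0.
move=> x y; have [->|xy] /= := eqVneq x y; first by rewrite pivot_irr.
exact: pivot_pm_parity2.
Qed.

End Pivot.

(** * Sequences of pivots *)

Lemma pivots_pm_parity G phi : symmetric G -> irreflexive G -> applicable G phi ->
  symmetric (pivots G phi) /\ irreflexive (pivots G phi) /\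
  forall X, pm_parity (pivots G phi) X =
    pm_parity G (symdiff (pivot_support phi) X).
Proof.
elim: phi G => [|[u v] phi IHphi] G G_sym G_irr /=.
  do 2!split=> //; move=> X; congr pm_parity.
  by apply/setP => z; rewrite in_symdiff in_pivot_support.
case/andP=> Guv app.
have [? [? IH]] := IHphi _ (pivot_sym u v G_sym) (pivot_irr u v G_irr) app.
do 2!split=> //; move=> X; rewrite IH pm_parity_pivot // symdiffA.
congr (pm_parity G (symdiff _ X)); apply/setP => z.
rewrite in_symdiff !in_pivot_support /= !inE !oddD !oddb addbA.
rewrite ![_ == z]eq_sym; congr (_ (+) _).
(* The ends of an edge differ, so membership in [[set u; v]] is an exclusive or. *)
by case: (z =P u) => // ->; case: eqP => // ?; subst; rewrite G_irr in Guv.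
Qed.

End MatchingParity.

Theorem theorem4 (T : finType) (G : rel T)
    (G_sym : symmetric G) (G_irr : irreflexive G)
    (phi : seq (T * T)) (phi_app : applicable G phi)
    (x y : T) (x_neq_y : x <> y) :
  pivots G phi x y <->
  pm_induced G (symdiff (pivot_support phi) [set x; y]) = 1.
Proof.
have [phi_sym [phi_irr phiE]] := pivots_pm_parity G_sym G_irr phi_app.
(* Adjacency of distinct vertices is the matching parity of the pair, which the support translates
   back to [G]. *)
rewrite -(pm_parity2 phi_sym phi_irr (introN eqP x_neq_y)) phiE.
exact: iff_sym (pm_induced_eq1 _ _).
Qed.
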